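(* Let $\mathcal P$ be a collection of probability measures on a measurable space $(\Omega,\mathcal F)$, and let $(X_n)_{n=1}^\infty$ be random variables on $(\Omega,\mathcal F)$ that are independent under every $P\in\mathcal P$. Suppose that for some $q\in[1,2]$ and some nondecreasing positive real sequence $(a_n)_{n=1}^\infty$ diverging to $\infty$, $$\sup_{P\in\mathcal P}\sum_{k=1}^\infty\frac{\mathbb E_P|X_k-\mathbb E_PX_k|^q}{a_k^q}<\infty\quad\text{and}\quad\lim_{m\to\infty}\sup_{P\in\mathcal P}\sum_{k=m}^\infty\frac{\mathbb E_P|X_k-\mathbb E_PX_k|^q}{a_k^q}=0.$$ Then for every $\varepsilon>0$, $$\lim_{m\to\infty}\sup_{P\in\mathcal P}P\left(\sup_{k\ge m}\left|\frac1{a_k}\sum_{i=1}^k(X_i-\mathbb E_P(X_i))\right|\ge\varepsilon\right)=0.$$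
   Context: $\mathbb E_P$ denotes expectation under $P$. It is understood that $\mathbb E_P|X_k|<\infty$ for every $k$ and every $P\in\mathcal P$, so that $\mathbb E_PX_k$ is well defined. The $X_k$ need not be identically distributed. *)

(* Defs.v *)
From HB Require Import structures.
From mathcomp Require Export all_boot all_order all_algebra finmap.
From mathcomp Require Export all_classical all_reals all_analysis.
Export Order.TTheory GRing.Theory Num.Theory.
Export numFieldNormedType.Exports.

#[export] Set Implicit Arguments.
#[export] Unset Strict Implicit.
#[export] Unset Printing Implicit Defensive.

#[global] Open Scope classical_set_scope.
#[global] Open Scope ring_scope.

(* Mutual independence of the whole family, not merely pairwise. *)
Definition independent_RVs (d d' : measure_display) (Omega : measurableType d)
    (T : measurableType d') (R : realType) (I : choiceType)
    (P : probability Omega R) (X : I -> {mfun Omega >-> T}) : Prop :=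
  forall (J : {fset I}) (B : I -> set T),
    (forall i, measurable (B i)) ->
    P (\bigcap_(i in [set` J]) (X i @^-1` B i)) =
    (\prod_(i <- J) P (X i @^-1` B i))%E.

Section CenteredSequence.
Context (d : measure_display) (Omega : measurableType d) (R : realType).
Implicit Types (P : probability Omega R) (X : nat -> {mfun Omega >-> R}).

(* `fine` discards nothing when X k is P-integrable. *)
Definition centered P X (k : nat) (w : Omega) : R :=
  X k w - fine ('E_P[X k])%E.

(* In \bar R, as the q-th absolute central moment may be +oo. *)
Definition scaled_moment P X (a : nat -> R) (q : R) (k : nat) : \bar R :=
  ('E_P[fun w => (`|centered P X k w| `^ q)%R] / (a k `^ q)%:E)%E.

(* Sequences are indexed from 0, X k and a k being the (k+1)-st terms: the
   k-th weighted sum therefore has the k+1 summands 0, ..., k. *)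
Definition scaled_sum P X (a : nat -> R) (k : nat) (w : Omega) : R :=
  (a k)^-1 * \sum_(0 <= i < k.+1) centered P X i w.

End CenteredSequence.

(* Main.v *)
Require Import Defs.
From mathcomp Require Import measurable_realfun ring lra.

(** The proof rests on a maximal inequality of Hajek-Renyi type for q in [1, 2]
    (hajek_renyi): for independent centered Y k, nondecreasing positive b k and
    eps > 0,

      P (exists k, |Y 0 + ... + Y k| >= eps * b k)
        <= 4 / eps `^ q * \sum_k E |Y k| `^ q / b k `^ q.

    Its source is the pointwise inequality
    |x + y| `^ q <= |x| `^ q + c * y + 4 * |y| `^ q, with c depending on x
    only (normD_powR_le). Take for x the current partial sum and for y the next
    variable, restrict to the event that the barrier has not been hit so far,
    and integrate: since this event and the partial sum depend on the past only,
    the linear term integrates to 0 and the q-th moment of the sum grows by at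
    most 4 * E |Y k| `^ q (integral_indic_normD_powR_le). The paths that hit the
    barrier at time k remove at least (eps * b k) `^ q times their probability
    from this moment; after division by b k `^ q these balances telescope. Integrating
    out the linear term at fixed x leaves nonnegative integrands only, so that
    Tonelli's theorem separates the past from the next variable.

    To reach a supremum over k >= m only, the inequality is applied with the
    barrier b k = a (maxn k m) (sup_scaled_sum_le). This leaves the series
    \sum_k E |Y k| `^ q / a (maxn k m) `^ q, which for every N <= m is at most
    (a N / a m) `^ q times the full series of scaled moments plus its tail from N
    (maxn_weighted_series_le). The tail is small uniformly in P by hypothesis when
    N is large, and, N being fixed, the first term is small uniformly in P when m
    is large, as the full series is bounded uniformly in P and a m tends to
    infinity. *)

(** * An inequality for powers of a sum *)

(** Concavity of a power with exponent in [0, 1]: the graph lies below its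
    tangent at 1. It is Young's inequality applied to u `^ r and 1 with the
    conjugate exponents r^-1 and (1 - r)^-1. *)
Lemma powR_le_tangent1 (R : realType) (u r : R) :
  0 <= u -> 0 <= r <= 1 -> u `^ r <= 1 + r * (u - 1).
Proof.
move=> u0 /andP[r0 r1].
have [->|rn0] := eqVneq r 0; first by rewrite powRr0; lra.
have [->|rn1] := eqVneq r 1; first by rewrite powRr1//; lra.
have {rn0}r0 : 0 < r by rewrite lt_neqAle eq_sym rn0.
have {rn1}r1 : r < 1 by rewrite lt_neqAle rn1.
have := @conjugate_powR _ (u `^ r) 1 r^-1 (1 - r)^-1 (powR_ge0 _ _) ler01.
rewrite !invr_gt0 subr_gt0 !invrK subrKC mulr1 powR1 mul1r => /(_ r0 r1 erefl).
rewrite -powRrM divff ?gt_eqF// powRr1//.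
by move=> h; apply: (le_trans h); lra.
Qed.

(** When |t| <= 1, write (1 + t) `^ q = (1 + t) * (1 + t) `^ (q - 1) and bound
    the second factor by its tangent, as q - 1 lies in [0, 1]; the error is at
    most t ^+ 2 <= |t| `^ q because q <= 2. When |t| > 1, each term is
    dominated by a multiple of |t| `^ q; the constant 4 bounds the factor 2 `^ q
    that comes from 1 + t <= 2 * t. *)
Lemma norm1D_powR_le (R : realType) (t q : R) : 1 <= q -> q <= 2 ->
  `|1 + t| `^ q <= 1 + q * t + 4 * `|t| `^ q.
Proof.
move=> q1 q2; have q0 : 0 < q by lra.
have tq0 := powR_ge0 `|t| q.
have [t1|t1] := leP `|t| 1.
  have t1' : 0 <= 1 + t by move: t1; rewrite ler_norml; lra.
  have qB : 0 <= q - 1 <= 1 by lra.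
  have := powR_le_tangent1 t1' qB.
  rewrite ger0_norm// -(@mulr_powRB1 _ (1 + t) q)// => h.
  have t2 : t ^+ 2 <= `|t| `^ q.
    have [->|tn0] := eqVneq t 0; first by rewrite expr0n powR_ge0.
    rewrite -[t ^+ 2]ger0_norm ?sqr_ge0// normrX -powR_mulrn//.
    by apply: ger_powR => //; rewrite normr_gt0 tn0.
  have := ler_wpM2l t1' h; have := sqr_ge0 t; nra.
have lin : `|t| <= `|t| `^ q by apply: le1r_powR => //; exact: ltW.
have [t0|t0] := leP 0 t.
  rewrite !ger0_norm//; last lra.
  rewrite ger0_norm// in t1 lin tq0 *.
  have : (1 + t) `^ q <= (2 * t) `^ q.
    by apply: ge0_ler_powR; rewrite ?nnegrE; lra.
  rewrite powRM//; have : 2 `^ q <= (2 : R) `^ 2 by apply: ler_powR; lra.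
  rewrite (powR_mulrn 2)// => h2 h.
  have h4 : 2 `^ q * t `^ q <= 2 ^+ 2 * t `^ q by rewrite ler_wpM2r.
  have qt : 0 <= q * t by rewrite mulr_ge0// ltW.
  by rewrite -natrX in h4; apply: (le_trans h); lra.
rewrite ltr0_norm// in t1 lin tq0 *.
have : `|1 + t| `^ q <= (- t) `^ q.
  apply: ge0_ler_powR; rewrite ?nnegrE//; try lra.
  by rewrite ler_norml; lra.
have : 0 <= (2 - q) * - t by rewrite mulr_ge0; lra.
by move=> h h'; apply: (le_trans h'); lra.
Qed.

(** The previous bound at t = y / x, by homogeneity. Only the linearity in y of
    the middle term matters afterwards, since it integrates to 0 against a
    centered law; hence the slope c, for nonzero x the derivative of
    |.| `^ q at x, stays existentially quantified. *)
Lemma normD_powR_le (R : realType) (q x : R) : 1 <= q -> q <= 2 ->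
  exists c : R, forall y, `|x + y| `^ q <= `|x| `^ q + c * y + 4 * `|y| `^ q.
Proof.
move=> q1 q2; have [->|x0] := eqVneq x 0.
  exists 0 => y; rewrite add0r mul0r addr0 normr0.
  have := powR_ge0 `|y| q; have := powR_ge0 (0 : R) q; lra.
exists (`|x| `^ q * q / x) => y.
have -> : x + y = x * (1 + y / x) by field.
rewrite normrM powRM//.
apply: (le_trans (ler_wpM2l (powR_ge0 _ _) (norm1D_powR_le (y / x) q1 q2))).
rewrite normrM normfV powRM ?invr_ge0//.
have xq : `|x| `^ q != 0 by rewrite powR_eq0 normr_eq0 (negbTE x0).
have -> : `|x|^-1 `^ q = (`|x| `^ q)^-1.
  by rewrite -powR_inv1// powRAC powR_inv1// powR_ge0.
rewrite le_eqVlt; apply/orP; left; apply/eqP.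
by field; rewrite x0 xq.
Qed.

(** * Integration of independent pairs *)

Section independent_pair.
Local Open Scope ereal_scope.
Context (d d1 d2 : measure_display) (Omega : measurableType d)
  (T1 : measurableType d1) (T2 : measurableType d2) (R : realType)
  (P : probability Omega R).

(** Independence says that the joint law of Z and Y agrees with the product of
    the two laws on rectangles, hence everywhere; Tonelli's theorem then
    separates the variables. *)
Lemma ge0_integral_indep (Z : {mfun Omega >-> T1}) (Y : {mfun Omega >-> T2})
    (f : (T1 * T2)%type -> \bar R) :
  (forall A B, measurable A -> measurable B ->
    P (Z @^-1` A `&` Y @^-1` B) = P (Z @^-1` A) * P (Y @^-1` B)) ->
  measurable_fun [set: T1 * T2] f -> (forall z, 0 <= f z) ->
  \int[P]_w f (Z w, Y w) = \int[P]_w \int[P]_v f (Z w, Y v).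
Proof.
move=> ZY mf f0.
have mZY : measurable_fun setT (fun w => (Z w, Y w)).
  by apply: measurable_fun_pair => //; exact: measurable_funPT.
pose ZYm : {mfun Omega >-> (T1 * T2)%type} := mfun_Sub (mem_set mZY).
have jE : forall X, measurable X ->
    (distribution P Z \x distribution P Y) X = distribution P ZYm X.
  apply: product_measure_unique => A B mA mB.
  by rewrite /distribution/= /pushforward -ZY.
transitivity (\int[distribution P ZYm]_z f z).
  by rewrite ge0_integral_distribution.
rewrite -(@eq_measure_integral _ _ _ setT _
    (distribution P Z \x distribution P Y)%E); last first.
  by move=> A mA _; exact: jE.
rewrite fubini_tonelli1// ge0_integral_distribution//=.
- apply: eq_integral => w _; rewrite /fubini_F ge0_integral_distribution//.
  exact: measurableT_comp.
- exact: measurable_fun_fubini_tonelli_F.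
- by move=> z; exact: integral_ge0.
Qed.

(** The pointwise bound of normD_powR_le, integrated: the linear term vanishes
    because Y is centered. *)
Lemma integral_normD_powR_le (Y : Omega -> R) (q x : R) :
  (1 <= q)%R -> (q <= 2)%R ->
  P.-integrable setT (EFin \o Y) -> 'E_P[Y] = 0 ->
  \int[P]_w (`|x + Y w| `^ q)%:E <=
    (`|x| `^ q)%:E + 4%:E * \int[P]_w (`|Y w| `^ q)%:E.
Proof.
move=> q1 q2 iY EY.
have q0 : (0 < q)%R by lra.
have mY : measurable_fun setT Y by apply/measurable_EFinP; case/integrableP: iY.
have mp (y : R) : measurable_fun setT (fun w => (`|y + Y w| `^ q)%:E).
  apply/measurable_EFinP; apply: (measurableT_comp (measurable_powR q)).
  by apply: measurableT_comp => //; apply: measurable_funD.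
have mp0 : measurable_fun setT (fun w => (`|Y w| `^ q)%:E).
  by have := mp 0%R; under eq_fun do rewrite add0r.
have p0 (y : R) : 0 <= (`|y| `^ q)%:E by rewrite lee_fin powR_ge0.
have [Yoo|Yfin] := eqVneq (\int[P]_w (`|Y w| `^ q)%:E) +oo.
  by rewrite Yoo gt0_muley ?lte_fin// addey// leey.
have ipY : P.-integrable setT (fun w => (`|Y w| `^ q)%:E).
  apply/integrableP; split => //.
  under eq_integral do rewrite gee0_abs//.
  by rewrite ltey.
have [c hc] := normD_powR_le x q1 q2.
have i1 : P.-integrable setT (fun w => (`|x| `^ q)%:E + c%:E * (Y w)%:E).
  apply: integrableD => //; first exact: finite_measure_integrable_cst.
  exact: integrableZl.
have i2 : P.-integrable setT (fun w => 4%:E * (`|Y w| `^ q)%:E).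
  exact: integrableZl.
apply: (@le_trans _ _ (\int[P]_w
    ((`|x| `^ q)%:E + c%:E * (Y w)%:E + 4%:E * (`|Y w| `^ q)%:E))).
  apply: ge0_le_integral => //.
  - by have /integrableP[] := integrableD measurableT i1 i2.
  - by move=> w _; rewrite -!EFinM -!EFinD lee_fin; exact: hc.
rewrite integralD// integralD//; last 2 first.
- exact: finite_measure_integrable_cst.
- exact: integrableZl.
rewrite integral_cst// [X in _ * X]probability_setT mule1 integralZl// integralZl//.
have -> : \int[P]_w (Y w)%:E = 0 by rewrite -EY unlock.
by rewrite mule0 adde0.
Qed.
End independent_pair.

(** * Independence of the past *)

Section past.
Local Open Scope ereal_scope.
Context (d : measure_display) (Omega : measurableType d) (R : realType).
Implicit Types (P : probability Omega R) (Y : nat -> {mfun Omega >-> R}).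

(** These sets form a pi-system, and they generate the sigma-algebra of the
    variables Y 0, ..., Y k.-1. *)
Definition past_rectangles Y (k : nat) : set (set Omega) :=
  [set \bigcap_(i in `I_k) (Y i @^-1` B i) |
     B in [set B : nat -> set R | forall i, measurable (B i)]].

(** The carrier Omega with this smaller sigma-algebra, as a measurable type of
    its own: being a function of Y 0, ..., Y k.-1 is then plain measurability
    on past Y k, and the identity Omega -> past Y k plays the role of the random
    vector (Y 0, ..., Y k.-1). *)
Definition past Y k := g_sigma_algebraType (past_rectangles Y k).

Lemma measurable_past_RV Y k i : (i < k)%N ->
  measurable_fun [set: past Y k] (Y i : past Y k -> R).
Proof.
move=> ik _ B mB; rewrite setTI; apply: sub_sigma_algebra.
exists (fun j => if j == i then B else setT) => /= [j|]; first by case: ifP.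
apply/seteqP; split => w /=; first by move=> /(_ i ik); rewrite /= eqxx.
by move=> Yi j _; case: eqP => [->|].
Qed.

Lemma past_rectangles_measurable Y k : past_rectangles Y k `<=` measurable.
Proof.
move=> _ [B mB <-]; apply: bigcap_measurableType => i _.
exact: measurable_funPTI.
Qed.

Lemma measurable_past Y k (A : set Omega) :
  measurable (A : set (past Y k)) -> measurable A.
Proof.
move=> mA; apply: (smallest_sub (@sigma_algebra_measurable _ Omega) _ mA).
exact: past_rectangles_measurable.
Qed.

(** Both sides are finite measures in A, and on the pi-system of rectangles
    they agree by independence of the family; hence they agree on the
    sigma-algebra that it generates. *)
Lemma past_indep P Y k (A : set Omega) (B : set R) : independent_RVs P Y ->
  measurable (A : set (past Y k)) -> measurable B ->
  P (A `&` Y k @^-1` B) = P A * P (Y k @^-1` B).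
Proof.
move=> YI mA mB; have mYB : measurable (Y k @^-1` B) by exact: measurable_funPTI.
have fYB : P (Y k @^-1` B) \is a fin_num by exact: fin_num_measure.
pose r := NngNum (fine_ge0 (measure_ge0 P (Y k @^-1` B))).
have -> : P A * P (Y k @^-1` B) = mscale r P A.
  by rewrite /mscale/= fineK// muleC.
have -> : P (A `&` Y k @^-1` B) = mrestr P mYB A by [].
apply: (g_sigma_algebra_measure_unique (past_rectangles Y k)
  (@past_rectangles_measurable Y k) (fun=> setT)) => //.
- move=> _; exists (fun=> setT) => //.
  by apply/seteqP; split => // w _ i _.
- by apply/seteqP; split => // w _; exists 0%N.
- move=> _ _ [B1 mB1 <-] [B2 mB2 <-]; exists (fun i => B1 i `&` B2 i).
    by move=> i; exact: measurableI.
  rewrite -bigcapI; apply: eq_bigcapr => i _; exact: preimage_setI.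
- move=> _ [C mC <-].
  (* Independence of the finite families J and k |` J, with B placed at
     index k, gives the product formula. *)
  pose J := [fset i in iota 0 k]%fset.
  have JE : `I_k = [set` J].
    by apply/seteqP; split => i /=; rewrite !inE/= mem_iota.
  have kJ : k \notin J by rewrite !inE/= mem_iota ltnn.
  pose C' i := if i == k then B else C i.
  have mC' i : measurable (C' i) by rewrite /C'; case: ifP.
  have eqC i : `I_k i -> Y i @^-1` C i = Y i @^-1` C' i.
    by move=> /= ik; rewrite /C' ltn_eqF.
  have := YI (k |` J)%fset C' mC'; rewrite big_fsetU1//= -(YI J C' mC') -JE.
  rewrite -(eq_bigcapr eqC) {2}/C' eqxx /mscale/= fineK// => <-.
  rewrite /mrestr/=; congr (P _).
  rewrite (eq_bigcapr eqC) JE; apply/seteqP; split => [w [h hk] i /=|w h].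
    rewrite !inE => /orP[/eqP ->|iJ]; first by rewrite /C' eqxx.
    by apply: h; rewrite /= !inE.
  split => [i /= iJ|].
    by apply: h; rewrite /= !inE in iJ *; rewrite iJ orbT.
  by have := h k; rewrite /C' eqxx; apply; rewrite /= !inE eqxx.
- by move=> _; rewrite /= /mrestr setTI ltey_eq fYB.
Qed.

(** One step of the martingale argument, without conditional expectations: given
    the past, A and S are frozen and Y k is a centered independent variable, so
    that integral_normD_powR_le applies inside the Tonelli integral. *)
Lemma integral_indic_normD_powR_le P Y k (q : R) (A : set Omega)
    (S : Omega -> R) :
  independent_RVs P Y -> (1 <= q)%R -> (q <= 2)%R ->
  P.-integrable setT (EFin \o Y k) -> 'E_P[Y k] = 0 ->
  measurable (A : set (past Y k)) ->
  measurable_fun [set: past Y k] (S : past Y k -> R) ->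
  \int[P]_w (\1_A w * `|S w + Y k w| `^ q)%:E <=
    \int[P]_w (\1_A w * `|S w| `^ q)%:E + 4%:E * 'E_P[fun w => `|Y k w| `^ q]%R.
Proof.
move=> YI q1 q2 iY EY mA mS.
have mid : measurable_fun setT (id : Omega -> past Y k).
  by move=> _ B mB; rewrite setTI; exact: measurable_past mB.
pose Z : {mfun Omega >-> past Y k} := mfun_Sub (mem_set mid).
have mSO : measurable_fun [set: Omega] S.
  by move=> _ B mB; apply: (@measurable_past Y k); exact: mS.
pose f (z : past Y k * R) : \bar R := (\1_A z.1 * `|S z.1 + z.2| `^ q)%:E.
have mpow : measurable_fun setT (fun y : R => `|y| `^ q)%R.
  by apply: (measurableT_comp (measurable_powR q)); exact: normr_measurable.
have mf : measurable_fun setT f.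
  apply/measurable_EFinP; apply: measurable_funM.
    apply: measurableT_comp; last exact: measurable_fst.
    exact: measurable_indic.
  apply: (measurableT_comp mpow); apply: measurable_funD.
    by apply: measurableT_comp; [exact: mS|exact: measurable_fst].
  exact: measurable_snd.
have f0 z : 0 <= f z by rewrite lee_fin mulr_ge0// powR_ge0.
have -> : \int[P]_w (\1_A w * `|S w + Y k w| `^ q)%:E
    = \int[P]_w f (Z w, Y k w) by [].
rewrite ge0_integral_indep//; last by move=> C B mC mB; exact: past_indep.
have E0 : 0 <= 4%:E * 'E_P[fun w => `|Y k w| `^ q]%R.
  by rewrite mule_ge0// unlock integral_ge0// => w _; rewrite lee_fin powR_ge0.
have mAS : measurable_fun setT (fun w => (\1_A w * `|S w| `^ q)%:E).
  apply/measurable_EFinP/measurable_funM.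
    by apply: measurable_indic; exact: (@measurable_past Y k).
  exact: (measurableT_comp mpow).
rewrite -[leRHS]adde0 -[X in _ + X + _]mule1 -(@probability_setT _ _ _ P).
rewrite adde0 -integral_cst//= -ge0_integralD//.
apply: ge0_le_integral => //.
- by move=> w _; exact: integral_ge0.
- have mfY : measurable_fun setT
      (fun zv : past Y k * Omega => f (zv.1, Y k zv.2)).
    apply: (measurableT_comp mf); apply: measurable_fun_pair.
      exact: measurable_fst.
    by apply: measurableT_comp; [exact: measurable_funPT|exact: measurable_snd].
  have mF := @measurable_fun_fubini_tonelli_F _ _ _ _ _ P _ mfY (fun=> f0 _).
  by move=> _ B mB; apply: (@measurable_past Y k); exact: mF.
- by apply: emeasurable_funD.
move=> w _; rewrite /f/= indicE; case: (w \in A); last first.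
  rewrite mul0r; under eq_integral do rewrite mul0r.
  by rewrite integral0 add0e.
rewrite mul1r; under eq_integral do rewrite mul1r.
by rewrite unlock; exact: integral_normD_powR_le.
Qed.

End past.

(** * The maximal inequality *)

Section hajek_renyi.
Local Open Scope ereal_scope.
Context (d : measure_display) (Omega : measurableType d) (R : realType).
Context (P : probability Omega R) (Y : nat -> {mfun Omega >-> R}).
Context (q : R) (b : nat -> R) (eps : R).
Context (Y_indep : independent_RVs P Y).
Context (Y_int : forall k, P.-integrable setT (EFin \o Y k)).
Context (Y_centered : forall k, 'E_P[Y k] = 0).
Context (q_ge1 : (1 <= q)%R).
Context (q_le2 : (q <= 2)%R).
Context (b_gt0 : forall k, (0 < b k)%R).
Context (b_nd : nondecreasing_seq b).
Context (eps_gt0 : (0 < eps)%R).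

Let S n (w : Omega) : R := (\sum_(0 <= i < n) Y i w)%R.
Let hit n : set Omega := [set w | (eps * b n <= `|S n.+1 w|)%R].
Let alive n : set Omega := ~` \big[setU/set0]_(k < n) hit k.
Let alive_moment n := \int[P]_w (\1_(alive n) w * `|S n w| `^ q)%:E.
Let moment n := 'E_P[fun w => `|Y n w| `^ q]%R.

Let measurable_past_S k n : (n <= k)%N ->
  measurable_fun [set: past Y k] (S n : past Y k -> R).
Proof.
move=> nk; rewrite /S; under eq_fun do rewrite big_mkord.
apply: measurable_sum => i.
exact: measurable_past_RV (leq_trans (ltn_ord i) nk).
Qed.

Let measurable_past_hit k n : (n < k)%N -> measurable (hit n : set (past Y k)).
Proof.
move=> nk.
have mN : measurable_fun [set: past Y k] (fun w : past Y k => `|S n.+1 w|%R).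
  apply: measurableT_comp => //; exact: measurable_past_S.
have := mN measurableT `[(eps * b n)%R, +oo[%classic (measurable_itv _).
rewrite setTI; congr (measurable _).
by apply/seteqP; split => w; rewrite /hit/= in_itv/= andbT.
Qed.

Let measurable_past_alive n : measurable (alive n : set (past Y n)).
Proof.
apply: measurableC; apply: bigsetU_measurable => i _.
exact: measurable_past_hit.
Qed.

Let aliveS n : alive n.+1 = alive n `\` hit n.
Proof. by rewrite /alive big_ord_recr/= setCU setDE. Qed.

Let seqDU_hit n : seqDU hit n = alive n `&` hit n.
Proof. by rewrite /seqDU setDE setIC. Qed.

Let mS n : measurable_fun [set: Omega] (S n).
Proof.
by move=> _ B mB; apply: (@measurable_past _ _ _ Y n); exact: measurable_past_S.
Qed.

Let malive n : measurable (alive n).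
Proof. by apply: (@measurable_past _ _ _ Y n); exact: measurable_past_alive. Qed.

Let mhit n : measurable (hit n).
Proof. by apply: (@measurable_past _ _ _ Y n.+1); exact: measurable_past_hit. Qed.

Let mD n : measurable (seqDU hit n).
Proof. by rewrite seqDU_hit; apply: measurableI. Qed.

Let measurable_norm_powR (f : Omega -> R) : measurable_fun setT f ->
  measurable_fun setT (fun w => `|f w| `^ q)%R.
Proof.
move=> mf; apply: (measurableT_comp (measurable_powR q)).
exact: measurableT_comp.
Qed.

Let measurable_indic_norm_powR (A : set Omega) (f : Omega -> R) : measurable A ->
  measurable_fun setT f ->
  measurable_fun setT (fun w => (\1_A w * `|f w| `^ q)%:E).
Proof.
move=> mA mf; apply/measurable_EFinP/measurable_funM.
  exact: measurable_indic.
exact: measurable_norm_powR.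
Qed.

(** On the step from n to n.+1, the paths that hit the barrier at n leave
    alive, and each takes with it at least (eps * b n) `^ q. *)
Let alive_moment_step n :
  alive_moment n.+1 + ((eps * b n) `^ q)%:E * P (seqDU hit n) <=
    alive_moment n + 4%:E * moment n.
Proof.
have sums w : S n.+1 w = (S n w + Y n w)%R by rewrite /S big_nat_recr.
apply: (@le_trans _ _ (\int[P]_w (\1_(alive n) w * `|S n.+1 w| `^ q)%:E));
  last first.
  under eq_integral do rewrite sums.
  apply: integral_indic_normD_powR_le => //.
  exact: measurable_past_S.
have p0 : (0 <= (eps * b n) `^ q)%R by exact: powR_ge0.
have -> : P (seqDU hit n) = \int[P]_w (\1_(seqDU hit n) w)%:E.
  by rewrite integral_indic// setIT.
have m1D : measurable_fun setT (fun w => (\1_(seqDU hit n) w)%:E : \bar R).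
  by apply/measurable_EFinP; apply: measurable_indic; exact: mD.
have mV k : measurable_fun setT (fun w => (\1_(alive k) w * `|S n.+1 w| `^ q)%:E).
  exact: measurable_indic_norm_powR.
have mZ : measurable_fun setT
    (fun w => ((eps * b n) `^ q)%:E * (\1_(seqDU hit n) w)%:E).
  exact: measurable_funeM.
have Z0 w : 0 <= ((eps * b n) `^ q)%:E * (\1_(seqDU hit n) w)%:E.
  by rewrite -EFinM lee_fin mulr_ge0.
rewrite -ge0_integralZl// -ge0_integralD//.
apply: ge0_le_integral => //.
- by move=> w _; rewrite -EFinM -EFinD lee_fin addr_ge0// mulr_ge0// powR_ge0.
- exact: emeasurable_funD.
move=> w _; rewrite -EFinM -EFinD lee_fin seqDU_hit aliveS.
rewrite setDE !indicE !in_setI in_setC.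
have [hw|hw] := boolP (w \in hit n).
  rewrite andbF andbT mul0r add0r mulrC ler_wpM2l//.
  have q0 : (0 <= q)%R by rewrite (le_trans ler01).
  have be0 : (0 <= eps * b n)%R by rewrite mulr_ge0 ?ltW.
  by apply: ge0_ler_powR => //; rewrite ?nnegrE//; move: hw; rewrite inE.
by rewrite !andbT andbF mulr0 addr0.
Qed.

Let alive_moment0 : alive_moment 0 = 0.
Proof.
rewrite /alive_moment; under eq_integral do
  rewrite /S big_geq// normr0 powR0 ?mulr0 ?gt_eqF ?(lt_le_trans ltr01)//.
by rewrite integral0.
Qed.

Let alive_moment_ge0 n : 0 <= alive_moment n.
Proof.
by apply: integral_ge0 => w _; rewrite lee_fin mulr_ge0// powR_ge0.
Qed.

Let moment_ge0 n : 0 <= moment n.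
Proof.
by rewrite /moment unlock; apply: integral_ge0 => w _; rewrite lee_fin powR_ge0.
Qed.

Let term k := (moment k / (b k `^ q)%:E).

Let bq_gt0 k : (0 < b k `^ q)%R. Proof. by rewrite powR_gt0. Qed.

Let termE k : term k = ((b k `^ q)^-1)%:E * moment k.
Proof. by rewrite /term muleC inver gt_eqF. Qed.

Let term_ge0 k : 0 <= term k.
Proof. by rewrite termE mule_ge0// lee_fin invr_ge0 ltW. Qed.

(** Dividing the step inequality by b n `^ q and replacing this divisor by the
    larger b n.+1 `^ q on the surviving part makes the inequalities telescope. *)
Let stopped_bound n :
  ((b n `^ q)^-1)%:E * alive_moment n +
    \sum_(0 <= k < n) (eps `^ q)%:E * P (seqDU hit k) <=
  4%:E * \sum_(0 <= k < n) term k.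
Proof.
elim: n => [|n IH]; first by rewrite !big_geq// alive_moment0 !mule0 adde0.
rewrite !big_nat_recr//= (ge0_muleDr 4%:E)//; last by rewrite sume_ge0.
apply: le_trans (leeD2r _ IH).
rewrite addeA [leLHS]addeAC [leRHS]addeAC leeD2r//.
have bqS : ((b n.+1 `^ q)^-1 <= (b n `^ q)^-1)%R.
  have q0 : (0 <= q)%R by rewrite (le_trans ler01).
  have b0 k : (0 <= b k)%R by exact: ltW.
  by rewrite lef_pV2 ?posrE//; apply: ge0_ler_powR; rewrite ?nnegrE//; exact: b_nd.
have bqV : 0 <= ((b n `^ q)^-1)%:E by rewrite lee_fin invr_ge0 ltW.
apply: (@le_trans _ _ (((b n `^ q)^-1)%:E *
    (alive_moment n.+1 + ((eps * b n) `^ q)%:E * P (seqDU hit n)))).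
  rewrite (ge0_muleDr _ (alive_moment_ge0 n.+1)); last first.
    by rewrite mule_ge0// lee_fin powR_ge0.
  rewrite leeD//; first by rewrite lee_wpmul2r.
  rewrite muleA -EFinM powRM; [|exact: ltW|exact: ltW].
  by rewrite [(eps `^ q * _)%R]mulrC mulKf// gt_eqF.
apply: (le_trans (lee_wpmul2l bqV (alive_moment_step n))).
by rewrite (ge0_muleDr _ (alive_moment_ge0 n)) ?mule_ge0// termE muleCA.
Qed.

(** A Hajek-Renyi inequality for moments of order q in [1, 2]. The first hitting
    sets seqDU hit k are disjoint and cover the event, so stopped_bound
    controls the partial sums of its probability. *)
Lemma hajek_renyi :
  P [set w | exists k, (eps * b k <= `|\sum_(0 <= i < k.+1) Y i w|)%R] <=
  (4 / eps `^ q)%:E *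
    \sum_(0 <= k <oo) ('E_P[fun w => `|Y k w| `^ q]%R / (b k `^ q)%:E).
Proof.
have eq_gt0 : (0 < eps `^ q)%R by rewrite powR_gt0.
have -> : [set w | exists k, (eps * b k <= `|\sum_(0 <= i < k.+1) Y i w|)%R]
    = \bigcup_k seqDU hit k.
  rewrite -seqDU_bigcup_eq; apply/seteqP; split => w [k]; first by exists k.
  by move=> _ h; exists k.
rewrite mulrC EFinM -muleA -lee_pdivrMl ?invr_gt0// invrK.
rewrite measure_bigcup//= (eq_eseriesl (Q := predT)); last first.
  by move=> k; rewrite in_setT.
rewrite -nneseriesZl//.
apply: lime_le.
  by apply: is_cvg_nneseries => k _ _; rewrite mule_ge0// lee_fin ltW.
near=> n.
have scaled_ge0 : 0 <= ((b n `^ q)^-1)%:E * alive_moment n.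
  by rewrite mule_ge0// lee_fin invr_ge0 ltW.
apply: (le_trans (le_trans (leeDr _ scaled_ge0) (stopped_bound n))).
by rewrite lee_wpmul2l//; apply: nneseries_lim_ge => k _ _; exact: term_ge0.
Unshelve. all: end_near. Qed.
End hajek_renyi.

(** * Limits and weighted series *)

Section series.
Context (R : realType).

Lemma ge0_cvge0 (u : nat -> \bar R) : (forall n, 0 <= u n)%E ->
  (forall e : R, 0 < e -> \forall n \near \oo, (u n <= e%:E)%E) ->
  u n @[n --> \oo] --> 0%E.
Proof.
move=> u0 ue; apply/fine_cvgP; split.
  near=> n; rewrite ge0_fin_numE//; apply: le_lt_trans (ltry 1).
  by near: n; exact: ue.
apply/cvgrPdist_le => e e0; near=> n.
rewrite sub0r normrN ger0_norm; last exact: fine_ge0.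
rewrite -lee_fin fineK; first by near: n; exact: ue.
rewrite ge0_fin_numE//; apply: le_lt_trans (ltry e).
by near: n; exact: ue.
Unshelve. all: end_near. Qed.

(** Kronecker's lemma in quantitative form. The indices k < N carry the weight
    a m in place of a k, which gains the factor (a N / a m) `^ q; for the
    indices k >= N the weight a (maxn k m) is at least a k. *)
Lemma maxn_weighted_series_le (M : nat -> \bar R) (a : nat -> R) (q : R)
    (N m : nat) :
  (forall k, 0 <= M k)%E -> (forall k, 0 < a k) -> nondecreasing_seq a ->
  0 <= q -> (N <= m)%N ->
  (\sum_(0 <= k <oo) M k / (a (maxn k m) `^ q)%:E <=
   ((a N / a m) `^ q)%:E * \sum_(0 <= k <oo) M k / (a k `^ q)%:E +
   \sum_(N <= k <oo) M k / (a k `^ q)%:E)%E.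
Proof.
move=> M0 a0 and q0 Nm.
have aq0 k : 0 < a k `^ q by rewrite powR_gt0.
have divE k n : (M k / (a n `^ q)%:E = ((a n `^ q)^-1)%:E * M k)%E.
  by rewrite muleC inver gt_eqF.
have t0 k n : (0 <= M k / (a n `^ q)%:E)%E.
  by rewrite divE mule_ge0// lee_fin invr_ge0 ltW.
have apow k n : (k <= n)%N -> a k `^ q <= a n `^ q.
  move=> kn; apply: ge0_ler_powR => //; rewrite ?nnegrE; try exact: ltW.
  exact: and.
rewrite (nneseries_split 0 N)// add0n.
apply: leeD.
  apply: (@le_trans _ _ (((a N / a m) `^ q)%:E *
      \sum_(0 <= k < N) M k / (a k `^ q)%:E)%E); last first.
    by rewrite lee_wpmul2l ?lee_fin ?powR_ge0//; exact: nneseries_lim_ge.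
  rewrite ge0_sume_distrr//; rewrite !big_nat; apply: lee_sum => k /andP[_ kN].
  rewrite (maxn_idPr _); last exact: leq_trans (ltnW kN) Nm.
  rewrite !divE muleA -EFinM lee_wpmul2r// lee_fin.
  have a_ge0 n : 0 <= a n by exact: ltW.
  have -> : (a N / a m) `^ q = a N `^ q / a m `^ q.
    rewrite powRM ?invr_ge0//; congr (_ * _).
    by rewrite -powR_inv1// powRAC powR_inv1// powR_ge0.
  rewrite mulrAC ler_peMl ?invr_ge0 ?powR_ge0//.
  by rewrite ler_pdivlMr// mul1r; apply: apow; exact: ltnW.
rewrite [leLHS]eseries_cond [leRHS]eseries_cond.
apply: lee_nneseries => // k /= Nk.
rewrite !divE lee_wpmul2r// lee_fin lef_pV2 ?posrE//.
by apply: apow; exact: leq_maxl.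
Qed.
End series.

(** * Centered variables *)

Section centered.
Context (d : measure_display) (Omega : measurableType d) (R : realType).
Context (P : probability Omega R) (X : nat -> {mfun Omega >-> R}).

Lemma measurable_centered k : measurable_fun [set: Omega] (centered P X k).
Proof. by apply: measurable_funB. Qed.

Definition centered_RV k : {mfun Omega >-> R} :=
  mfun_Sub (mem_set (measurable_centered k)).

Lemma independent_centered :
  independent_RVs P X -> independent_RVs P centered_RV.
Proof.
move=> XI J B mB.
pose B' k := (fun x => x - fine ('E_P[X k])%E) @^-1` B k.
have mB' k : measurable (B' k).
  have mtr : measurable_fun setT (fun x : R => x - fine ('E_P[X k])%E).
    by apply: measurable_funB.
  by rewrite -[B' k]setTI; apply: mtr.
exact: (XI J B' mB').
Qed.

Hypothesis X_int : forall k, P.-integrable [set: Omega] (EFin \o X k).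

Lemma integrable_centered k :
  P.-integrable [set: Omega] (EFin \o centered_RV k).
Proof.
have : P.-integrable setT (fun w => (X k w)%:E - (fine ('E_P[X k])%E)%:E)%E.
  apply: integrableB => //; first exact: X_int.
  exact: finite_measure_integrable_cst.
by [].
Qed.

Lemma expectation_centered k : ('E_P[centered_RV k] = 0)%E.
Proof.
have EX : 'E_P[X k]%E \is a fin_num.
  by rewrite unlock; exact: (integrable_fin_num measurableT (X_int k)).
rewrite unlock; under eq_integral do rewrite /= /centered EFinB.
rewrite integralB_EFin//; last exact: finite_measure_integrable_cst.
rewrite integral_cst// [X in (_ * X)%E]probability_setT mule1 fineK//.
have -> : (\int[P]_w (X k w)%:E = 'E_P[X k])%E by rewrite unlock.
by rewrite subee.
Qed.

(** The supremum over k >= m is dominated by the maximal function of all the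
    partial sums for the barrier k |-> a (maxn k m), which is constant up to m
    and then follows a. The level eps / 2 replaces eps because the supremum need
    not be attained. *)
Lemma sup_scaled_sum_le (q : R) (a : nat -> R) (eps : R) (m : nat) :
  independent_RVs P X -> 1 <= q -> q <= 2 ->
  (forall k, 0 < a k) -> nondecreasing_seq a -> 0 < eps ->
  (P [set w | eps%:E <= ereal_sup [set `|scaled_sum P X a k w|%:E
                                  | k in [set k | (m <= k)%N]]] <=
   (4 / (eps / 2) `^ q)%:E *
   \sum_(0 <= k <oo) 'E_P[fun w => (`|centered P X k w| `^ q)%R] /
                     (a (maxn k m) `^ q)%:E)%E.
Proof.
move=> XI q1 q2 a0 and e0.
have e20 : 0 < eps / 2 by lra.
have amax : nondecreasing_seq (fun k => a (maxn k m)).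
  by move=> i j ij; apply: and; rewrite geq_max leq_maxr (leq_trans ij) ?leq_maxl.
apply: le_trans (hajek_renyi (independent_centered XI) integrable_centered
  expectation_centered q1 q2 (fun k => a0 (maxn k m)) amax e20).
have mS k : measurable_fun setT (fun w => \sum_(0 <= i < k.+1) centered_RV i w).
  exact: measurable_sum.
apply: le_measure; rewrite ?inE.
- have mscaled k :
      measurable_fun setT (fun w => `|scaled_sum P X a k w|%:E : \bar R).
    apply/measurable_EFinP; apply: measurableT_comp => //.
    exact: measurable_funM.
  have := emeasurable_fun_c_infty measurableT (measurable_fun_esups mscaled m)
    eps%:E.
  by rewrite setTI.
- have -> : [set w | exists k, eps / 2 * a (maxn k m) <=
        `|\sum_(0 <= i < k.+1) centered_RV i w|] =
      \bigcup_k ((fun w => `|\sum_(0 <= i < k.+1) centered_RV i w|) @^-1`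
        `[eps / 2 * a (maxn k m), +oo[).
    apply/seteqP; split => w /= [k].
      by move=> h; exists k => //; rewrite /= in_itv/= andbT.
    by move=> _; rewrite /= in_itv/= andbT => h; exists k.
  apply: bigcup_measurable => k _; rewrite -[X in measurable X]setTI.
  by apply: (measurableT_comp (@normr_measurable R setT) (mS k)) => //.
move=> w /= he.
have : ((eps / 2)%:E < ereal_sup [set `|scaled_sum P X a k w|%:E
                                  | k in [set k | (m <= k)%N]])%E.
  by apply: lt_le_trans he; rewrite lte_fin; lra.
move=> /ereal_sup_gt[_ [k /= mk <-]]; rewrite lte_fin => hk; exists k.
rewrite (maxn_idPl mk) -ler_pdivlMr//.
move: hk; rewrite /scaled_sum normrM normfV.
by rewrite (gtr0_norm (a0 k)) [ltRHS]mulrC => /ltW.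
Qed.

End centered.

(** * The uniform strong law *)

Theorem theorem2 (d : measure_display) (Omega : measurableType d)
    (R : realType) (PP : set (probability Omega R))
    (X : nat -> {mfun Omega >-> R}) (q : R) (a : nat -> R)
    (X_int : forall P : probability Omega R, PP P ->
       forall k : nat, P.-integrable [set: Omega] (EFin \o X k))
    (X_indep : forall P : probability Omega R, PP P -> independent_RVs P X)
    (q_ge1 : 1 <= q) (q_le2 : q <= 2)
    (a_gt0 : forall k : nat, 0 < a k)
    (a_nd : nondecreasing_seq a)
    (a_oo : a k @[k --> \oo] --> +oo)
    (sum_bounded :
       (ereal_sup [set (\sum_(0 <= k <oo) scaled_moment P X a q k)%E
                  | P in PP] < +oo)%E)
    (tail_cvg0 :
       ereal_sup [set (\sum_(m <= k <oo) scaled_moment P X a q k)%E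
                 | P in PP] @[m --> \oo] --> 0%E) :
  forall eps : R, 0 < eps ->
    ereal_sup [set P [set w : Omega |
                      (eps%:E <= ereal_sup [set `|scaled_sum P X a k w|%:E
                                           | k in [set k | (m <= k)%N]])%E]
              | P in PP] @[m --> \oo] --> 0%E.
Proof.
move=> eps eps0.
(* The supremum over an empty family is -oo, which cannot tend to 0. *)
have [PP0|/set0P[P0 PP0]] := eqVneq PP set0.
  move: tail_cvg0; rewrite PP0; under eq_fun do rewrite image_set0 ereal_sup0.
  move=> h; suff : (0 = -oo :> \bar R)%E by [].
  by apply: (cvg_unique (@ereal_hausdorff R) h); exact: cvg_cst.
have sm0 P k : (0 <= scaled_moment P X a q k)%E.
  rewrite /scaled_moment muleC inver gt_eqF ?powR_gt0// mule_ge0//.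
    by rewrite lee_fin invr_ge0 powR_ge0.
  by rewrite unlock; apply: integral_ge0 => w _; rewrite lee_fin powR_ge0.
have [K K0 HK] : exists2 K : R, 0 <= K & forall P, PP P ->
    (\sum_(0 <= k <oo) scaled_moment P X a q k <= K%:E)%E.
  set s := ereal_sup _ in sum_bounded.
  have ubs P : PP P -> (\sum_(0 <= k <oo) scaled_moment P X a q k <= s)%E.
    by move=> PPP; apply: ereal_sup_ubound; exists P.
  have s0 : (0 <= s)%E.
    apply: (le_trans _ (ubs _ PP0)).
    by apply: nneseries_ge0 => k _ _; exact: sm0.
  exists (fine s); first exact: fine_ge0.
  by rewrite fineK// ge0_fin_numE.
apply: ge0_cvge0 => [m|e e0].
  by apply: le_trans (ereal_sup_ubound (imageP _ PP0)); exact: measure_ge0.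
(* With C the constant of the maximal inequality, the head and the tail of the
   weighted series may each contribute dlt = e / (2 * C). *)
pose C := 4 / (eps / 2) `^ q.
have C0 : 0 < C by rewrite divr_gt0// powR_gt0// divr_gt0.
pose dlt := e / (2 * C).
have dlt0 : 0 < dlt by rewrite divr_gt0// mulr_gt0.
have [N _ HN] := tail_cvg0 _ (open_nbhs_nbhs
  (conj (@open_ereal_lt_ereal R dlt%:E) (eqbRL (lte_fin 0 dlt) dlt0))).
have tailN P : PP P -> (\sum_(N <= k <oo) scaled_moment P X a q k <= dlt%:E)%E.
  move=> PPP; apply: ltW; apply: le_lt_trans (HN N (leqnn N)).
  by apply: ereal_sup_ubound; exists P.
near=> m.
have Nm : (N <= m)%N by near: m; exact: nbhs_infty_ge.
have am : a N * K / dlt <= a m by near: m; move/cvgryPge : a_oo; exact.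
apply: ge_ereal_sup => _ [P PPP <-].
apply: le_trans (sup_scaled_sum_le (X_int P PPP) m (X_indep P PPP) q_ge1 q_le2
  a_gt0 a_nd eps0) _.
have q0 : 0 <= q by rewrite (le_trans ler01).
have E0 k : (0 <= 'E_P[fun w => (`|centered P X k w| `^ q)%R])%E.
  by rewrite unlock; apply: integral_ge0 => w _; rewrite lee_fin powR_ge0.
have main := maxn_weighted_series_le E0 a_gt0 a_nd q0 Nm.
have -> : e = C * (dlt + dlt).
  by rewrite /dlt; field; rewrite gt_eqF.
rewrite -/C [leRHS]EFinM; apply: lee_wpmul2l; first by rewrite lee_fin ltW.
apply: (le_trans main); rewrite EFinD; apply: leeD; last exact: tailN.
(* As a N / a m <= 1 <= q, the q-th power can be dropped. *)
apply: (@le_trans _ _ ((a N / a m)%:E * K%:E)%E).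
  apply: lee_pmul; rewrite ?lee_fin ?powR_ge0//.
  - by apply: nneseries_ge0 => k _ _; exact: sm0.
  - by apply: ge1r_powR => //; rewrite divr_gt0//= ler_pdivrMr// mul1r a_nd.
  - exact: HK.
rewrite -EFinM lee_fin mulrAC ler_pdivrMr//.
by move: am; rewrite ler_pdivrMr// [leRHS]mulrC.
Unshelve. all: end_near. Qed.
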